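(* Let $\pi = \{I_1,\ldots,I_m\}$ be a partition of $\{1,\ldots,N\}$, where $N \ge 1$. The maps $\Theta^\downarrow_\pi$ (restricted to $\overline{\mathcal{S}_\pi}$) and $\Theta^\uparrow_\pi$ are mutually inverse, rank-preserving isomorphisms between the unital $*$-algebras $\overline{\mathcal{S}_\pi}$ and $\mathbb{C}^{m\times m}$ equipped with the usual matrix multiplication. Furthermore, a matrix $A \in \overline{\mathcal{S}_\pi}$ is positive semidefinite if and only if $\Theta^\downarrow_\pi(A)$ is.
   Context: $\mathcal{S}_\pi$ is the set of $A \in \mathbb{C}^{N\times N}$ for which $\pi$ is the coarsest partition such that $A$ is constant on each block $I_i \times I_j$; its closure $\overline{\mathcal{S}_\pi}$ is the set of all $A \in \mathbb{C}^{N\times N}$ that are constant on each block $I_i \times I_j$. It is closed under matrix multiplication and is a unital algebra whose unit is its own (not in general the $N\times N$ identity matrix). The matrix $\mathcal{W}_\pi \in \mathbb{C}^{N \times m}$ has $(i,j)$ entry $1$ if $i \in I_j$ and $0$ otherwise, and $D_\pi := \mathcal{W}_\pi^*\mathcal{W}_\pi = \operatorname{diag}(|I_1|,\ldots,|I_m|)$. The linear operators $\Theta^\downarrow_\pi : \mathbb{C}^{N\times N}\to\mathbb{C}^{m\times m}$ and $\Theta^\uparrow_\pi : \mathbb{C}^{m\times m}\to\mathbb{C}^{N\times N}$ are \[ \Theta^\downarrow_\pi(A) := D_\pi^{-1/2}\mathcal{W}_\pi^* A \mathcal{W}_\pi D_\pi^{-1/2}, \qquad \Theta^\uparrow_\pi(B)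 := \mathcal{W}_\pi D_\pi^{-1/2} B D_\pi^{-1/2}\mathcal{W}_\pi^*. \] The involution $*$ is the conjugate transpose. *)

(* Defs.v *)
From mathcomp Require Import all_boot all_order all_algebra.
From mathcomp Require Import complex reals.

Set Implicit Arguments.
Unset Strict Implicit.
Unset Printing Implicit Defensive.

Import Order.TTheory GRing.Theory Num.Theory.

Local Open Scope ring_scope.
Local Open Scope sesquilinear_scope.

Section MatrixStarAlgebras.
Variable C : numClosedFieldType.

Definition psdmx n (A : 'M[C]_n) : Prop :=
  A \is hermsymmx /\ forall x : 'cV[C]_n, 0 <= (x ^t* *m A *m x) 0 0.

(* The unit e is the unit of S itself; it need not be 1%:M. *)
Definition unital_star_algebra n (S : {pred 'M[C]_n}) (e : 'M[C]_n) : Prop :=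
  [/\ submod_closed S,
      {in S &, forall A B, A *m B \in S},
      {in S, forall A, A ^t* \in S},
      e \in S
    & {in S, forall A, e *m A = A /\ A *m e = A}].

Definition unital_star_hom n p (S : {pred 'M[C]_n}) (e : 'M[C]_n)
    (T : {pred 'M[C]_p}) (e' : 'M[C]_p) (f : 'M[C]_n -> 'M[C]_p) : Prop :=
  [/\ {in S, forall A, f A \in T},
      {in S &, forall A B, forall a, f (a *: A + B) = a *: f A + f B},
      {in S &, forall A B, f (A *m B) = f A *m f B},
      {in S, forall A, f (A ^t*) = (f A) ^t*}
    & f e = e'].

Definition inverse_star_isos n p (S : {pred 'M[C]_n}) (e : 'M[C]_n)
    (T : {pred 'M[C]_p}) (e' : 'M[C]_p)
    (f : 'M[C]_n -> 'M[C]_p) (g : 'M[C]_p -> 'M[C]_n) : Prop :=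
  [/\ unital_star_algebra S e, unital_star_algebra T e',
      unital_star_hom S e T e' f, unital_star_hom T e' S e g
    & {in S, cancel f g} /\ {in T, cancel g f}].

End MatrixStarAlgebras.

Section Partition.
Variables (C : numClosedFieldType) (N m : nat) (I : 'I_m -> {set 'I_N}).

(* The blocks are listed without repetition; [partition] makes them nonempty,
   pairwise disjoint and covering. *)
Definition partition_family : Prop :=
  injective I /\ partition [set I j | j : 'I_m] [set: 'I_N].

(* The closure of the stratum of the partition. *)
Definition blockconstmx : {pred 'M[C]_N} :=
  [pred A : 'M[C]_N | [forall i : 'I_m, forall j : 'I_m,
    [forall k in I i, forall k' in I i, forall l in I j, forall l' in I j,
       A k l == A k' l']]].

Definition incidence_mx : 'M[C]_(N, m) := \matrix_(i, j) (i \in I j)%:R.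

Definition gram_mx : 'M[C]_m := incidence_mx ^t* *m incidence_mx.

(* Taking entrywise inverse square roots on the diagonal is legitimate since
   gram_mx is diagonal, see gram_mxE. *)
Definition gram_invsqrt : 'M[C]_m :=
  diag_mx (\row_j (sqrtC (gram_mx j j))^-1).

Definition Theta_down (A : 'M[C]_N) : 'M[C]_m :=
  gram_invsqrt *m incidence_mx ^t* *m A *m incidence_mx *m gram_invsqrt.

Definition Theta_up (B : 'M[C]_m) : 'M[C]_N :=
  incidence_mx *m gram_invsqrt *m B *m gram_invsqrt *m incidence_mx ^t*.

Lemma gram_mxE :
  partition_family -> gram_mx = diag_mx (\row_j #|I j|%:R).
Proof.
move=> [Iinj /and3P[_ /trivIsetP tI _]]; apply/matrixP => i j; rewrite !mxE.
under eq_bigr => k _ do rewrite !mxE rmorph_nat -natrM mulnb.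
rewrite -natr_sum; have [->|ij] := eqVneq i j.
  by rewrite mulr1n -sum1_card [in RHS]big_mkcond /=; congr _%:R;
     apply: eq_bigr => k _; rewrite andbb; case: (k \in I j).
rewrite mulr0n big1 // => k _; apply/eqP; rewrite eqb0; apply/negP => /andP[ki].
apply/negP; have := tI (I i) (I j) (imset_f _ _) (imset_f _ _).
by rewrite (inj_eq Iinj) => /(_ isT isT ij)/disjointFr ->.
Qed.

End Partition.

(* Main.v *)
Require Import Defs.
From mathcomp Require Import all_boot all_order all_algebra.
From mathcomp Require Import complex reals.

(** Put [V := W D^{-1/2}], with [W] the incidence matrix of the partition and
    [D = W^* W].  As [D] is diagonal with positive entries, [D^{-1/2}] is
    hermitian and [V^* V = D^{-1/2} D D^{-1/2} = 1]: [V] is an isometry from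
    [C^m] to [C^N] ([normalized_incidence_isometry]).  The downward map is the
    compression [A |-> V^* A V], and the upward map is [B |-> V B V^*].

    A matrix is constant on the blocks exactly when it has the form [W M W^*],
    [M] being the table of its block values ([blockconstmxP]).  Since
    [D^{-1/2}] is invertible, these are also the matrices [V B V^*]
    ([blockconstmx_rangeP]), so the block-constant matrices are the range of
    the upward map.

    Everything else holds for any isometry [V].  From [V^* V = 1] the
    compression undoes [B |-> V B V^*], and the latter is multiplicative:
    [V B V^* V B' V^* = V B B' V^*].  Hence its range is a *-algebra, whose
    unit is the projection [V V^*], and the two maps are inverse *-isomorphisms
    between this range and the full matrix algebra
    ([isometry_inverse_star_isos]).  A map [A |-> X^* A X] never increases the
    rank and keeps positive semidefiniteness, for any [X]; applied in both
    directions of a bijection this yields equality of ranks and the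
    equivalence of the positivity conditions. *)

Local Open Scope ring_scope.

Set Implicit Arguments.
Unset Strict Implicit.
Unset Printing Implicit Defensive.

Import Order.TTheory GRing.Theory Num.Theory.
Local Open Scope sesquilinear_scope.

Section Congruence.
Variable C : numClosedFieldType.

Lemma trmxC_mul m n p (A : 'M[C]_(m, n)) (B : 'M[C]_(n, p)) :
  (A *m B) ^t* = B ^t* *m A ^t*.
Proof. by rewrite trmx_mul map_mxM. Qed.

(** The two maps of the theorem are both of this shape, with [X] an isometry
    [V] for one and its adjoint for the other. *)
Definition congmx n p (X : 'M[C]_(n, p)) (A : 'M[C]_n) : 'M[C]_p :=
  X ^t* *m A *m X.

Lemma congmx_linear n p (X : 'M[C]_(n, p)) a A B :
  congmx X (a *: A + B) = a *: congmx X A + congmx X B.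
Proof. by rewrite /congmx mulmxDr mulmxDl -scalemxAr -scalemxAl. Qed.

Lemma congmx_trmxC n p (X : 'M[C]_(n, p)) A :
  congmx X (A ^t*) = (congmx X A) ^t*.
Proof. by rewrite /congmx !trmxC_mul trmxCK mulmxA. Qed.

Lemma mxrank_congmx_le n p (X : 'M[C]_(n, p)) A :
  (\rank (congmx X A) <= \rank A)%N.
Proof. exact: leq_trans (mxrankM_maxl _ _) (mxrankM_maxr _ _). Qed.

(** The quadratic form of [X^* A X] at [x] is that of [A] at [X x]. *)
Lemma psdmx_congmx n p (X : 'M[C]_(n, p)) A :
  psdmx A -> psdmx (congmx X A).
Proof.
rewrite /psdmx !is_hermitianmxE expr0 !scale1r => -[/eqP Aherm Apos].
split=> [|x]; first by rewrite -congmx_trmxC -Aherm.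
by have := Apos (X *m x); rewrite /congmx trmxC_mul !mulmxA.
Qed.

End Congruence.

Section Isometry.
Variables (C : numClosedFieldType) (n p : nat) (V : 'M[C]_(n, p)).
Hypothesis V_isometry : V ^t* *m V = 1%:M.

Lemma congmx_isometryK : cancel (congmx (V ^t*)) (congmx V).
Proof.
move=> B; rewrite /congmx trmxCK !mulmxA V_isometry mul1mx -mulmxA.
by rewrite V_isometry mulmx1.
Qed.

(** The inner factor [V^* V] of the product on the right collapses to [1]. *)
Lemma congmx_isometryM B B' :
  congmx (V ^t*) (B *m B') = congmx (V ^t*) B *m congmx (V ^t*) B'.
Proof.
rewrite /congmx trmxCK !mulmxA; congr (_ *m _ *m _).
by rewrite -[in RHS]mulmxA V_isometry mulmx1.
Qed.

Variable S : {pred 'M[C]_n}.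
Hypothesis S_range :
  forall A, reflect (exists B, A = congmx (V ^t*) B) (A \in S).

Lemma mem_congmx_isometry B : congmx (V ^t*) B \in S.
Proof. by apply/S_range; exists B. Qed.

Lemma congmx_isometry_inK : {in S, cancel (congmx V) (congmx (V ^t*))}.
Proof. by move=> A /S_range[B ->]; rewrite congmx_isometryK. Qed.

(** Membership in [S] lets every law be checked on matrices [V B V^*], where
    it reduces to the same law for [B].  The maps [f] and [g] are only required
    to agree pointwise with the two congruences, so that other expressions of
    these maps can be used without extensionality. *)
Lemma isometry_inverse_star_isos f g :
  f =1 congmx V -> g =1 congmx (V ^t*) ->
  inverse_star_isos S (congmx (V ^t*) 1%:M) predT 1%:M f g.
Proof.
move=> fE gE; split.
- split.
  + split=> [|a _ _ /S_range[B ->] /S_range[B' ->]].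
      by apply/S_range; exists 0; rewrite /congmx mulmx0 mul0mx.
    by rewrite -congmx_linear mem_congmx_isometry.
  + move=> _ _ /S_range[B ->] /S_range[B' ->].
    by rewrite -congmx_isometryM mem_congmx_isometry.
  + by move=> _ /S_range[B ->]; rewrite -congmx_trmxC mem_congmx_isometry.
  + exact: mem_congmx_isometry.
  + by move=> _ /S_range[B ->]; rewrite -!congmx_isometryM mul1mx mulmx1.
- by split=> // A _; rewrite mul1mx mulmx1.
- split=> //.
  + by move=> A B _ _ a; rewrite !fE congmx_linear.
  + move=> _ _ /S_range[B ->] /S_range[B' ->].
    by rewrite !fE -congmx_isometryM !congmx_isometryK.
  + by move=> A _; rewrite !fE congmx_trmxC.
  + by rewrite fE congmx_isometryK.
- split.
  + by move=> B _; rewrite gE mem_congmx_isometry.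
  + by move=> A B _ _ a; rewrite !gE congmx_linear.
  + by move=> A B _ _; rewrite !gE congmx_isometryM.
  + by move=> A _; rewrite !gE congmx_trmxC.
  + exact: gE.
- by split=> A A_in; rewrite fE gE (congmx_isometry_inK, congmx_isometryK).
Qed.

(** Congruence cannot increase the rank, and compressing by [V] gives [B]
    back. *)
Lemma mxrank_congmx_isometry B : \rank (congmx (V ^t*) B) = \rank B.
Proof.
apply/eqP; rewrite eqn_leq mxrank_congmx_le /=.
by rewrite -{1}[B]congmx_isometryK mxrank_congmx_le.
Qed.

Lemma mxrank_congmx_isometry_in :
  {in S, forall A, \rank (congmx V A) = \rank A}.
Proof.
by move=> A AS; rewrite -{2}[A]congmx_isometry_inK // mxrank_congmx_isometry.
Qed.

Lemma psdmx_congmx_isometry_in :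
  {in S, forall A, psdmx A <-> psdmx (congmx V A)}.
Proof.
move=> A AS; split=> psdA; first exact: psdmx_congmx.
by rewrite -[A]congmx_isometry_inK //; apply: psdmx_congmx.
Qed.

End Isometry.

Section Blocks.
Variables (C : numClosedFieldType) (N m : nat) (I : 'I_m -> {set 'I_N}).
Hypothesis I_part : partition_family I.

Local Notation W := (incidence_mx C I).
Local Notation Dinvsqrt := (gram_invsqrt C I).

Lemma partition_family_neq0 j : I j != set0.
Proof.
case: I_part => _ /and3P[_ _]; apply: contraNneq => <-.
exact: imset_f.
Qed.

(** A partition amounts to the function sending a point to the index of its
    block; in these terms row [k] of the incidence matrix is the basis vector
    of index [b k]. *)
Lemma partition_family_index :
  {b : 'I_N -> 'I_m | forall k j, (k \in I j) = (b k == j)}.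
Proof.
have [I_inj /and3P[/eqP I_cover /trivIsetP I_disj _]] := I_part.
have in_some_block k : exists i, k \in I i.
  have /bigcupP[_ /imsetP[i _ ->] k_i] : k \in cover [set I j | j : 'I_m].
    by rewrite I_cover inE.
  by exists i.
exists (fun k => xchoose (in_some_block k)) => k j.
set i := xchoose _; have k_i : k \in I i := xchooseP (in_some_block k).
have [<- // | ij] := eqVneq i j.
have := I_disj _ _ (imset_f I (x := i) isT) (imset_f I (x := j) isT).
by rewrite (inj_eq I_inj) => /(_ ij)/disjointFr->.
Qed.

(** The [(k, l)] entry of [W M W^*] is the entry of [M] at the blocks of [k]
    and [l].  Conversely a block-constant matrix is recovered from its values
    at one representative [r j] of each block. *)
Lemma blockconstmxP (A : 'M[C]_N) :
  reflect (exists M, A = congmx (W ^t*) M) (A \in blockconstmx I).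
Proof.
have [b bP] := partition_family_index.
have WE M k l : congmx (W ^t*) M k l = M (b k) (b l).
  rewrite /congmx trmxCK mxE (bigD1 (b l)) //= big1 => [|j]; last first.
    by rewrite !mxE bP eq_sym => /negPf->; rewrite rmorph0 mulr0.
  rewrite !mxE bP eqxx rmorph1 mulr1 addr0 (bigD1 (b k)) //= big1 => [|j].
    by rewrite !mxE bP eqxx mul1r addr0.
  by rewrite !mxE bP eq_sym => /negPf->; rewrite mul0r.
have entries_constP : reflect
    (forall k k' l l', b k = b k' -> b l = b l' -> A k l = A k' l')
    (A \in blockconstmx I).
  apply: (iffP 'forall_forallP) => A_const => [k k' l l' kk' ll' | i j].
    have /forall_inP/(_ k) := A_const (b k) (b l).
    rewrite bP eqxx => /(_ isT)/forall_inP/(_ k').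
    rewrite bP kk' eqxx => /(_ isT)/forall_inP/(_ l).
    rewrite bP eqxx => /(_ isT)/forall_inP/(_ l').
    by rewrite bP ll' eqxx => /(_ isT)/eqP.
  apply/forall_inP => k; rewrite bP => /eqP ki.
  apply/forall_inP => k'; rewrite bP => /eqP k'i.
  apply/forall_inP => l; rewrite bP => /eqP lj.
  apply/forall_inP => l'; rewrite bP => /eqP l'j.
  by apply/eqP/A_const; rewrite ?ki ?lj.
apply: (iffP entries_constP) => [A_const | [M ->]]; last first.
  by move=> k k' l l' kk' ll'; rewrite !WE kk' ll'.
have /fin_all_exists[r rP] : forall j, exists k, b k = j.
  by move=> j; have /set0Pn[k] := partition_family_neq0 j;
    rewrite bP => /eqP; exists k.
exists (\matrix_(i, j) A (r i) (r j)); apply/matrixP => k l.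
by rewrite WE mxE; apply: A_const; rewrite rP.
Qed.

(** The diagonal entries are inverse square roots of nonnegative numbers,
    hence real. *)
Lemma gram_invsqrt_trmxC : Dinvsqrt ^t* = Dinvsqrt.
Proof.
rewrite /gram_invsqrt tr_diag_mx map_diag_mx; congr diag_mx.
apply/rowP => j; rewrite gram_mxE // !mxE eqxx mulr1n.
by apply/CrealP/ger0_real; rewrite invr_ge0 sqrtC_ge0 ler0n.
Qed.

(** Blocks being nonempty, the cardinals on the diagonal of the Gram matrix
    are invertible. *)
Lemma gram_mx_normalized : Dinvsqrt *m gram_mx C I *m Dinvsqrt = 1%:M.
Proof.
rewrite /gram_invsqrt gram_mxE // !mulmx_diag -diag_const_mx; congr diag_mx.
apply/rowP => j; rewrite !mxE eqxx mulr1n mulrAC -invfM -expr2 sqrtCK mulVf //.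
by rewrite pnatr_eq0 cards_eq0 partition_family_neq0.
Qed.

Local Notation V := (W *m Dinvsqrt).

Lemma normalized_incidence_isometry : V ^t* *m V = 1%:M.
Proof. by rewrite trmxC_mul gram_invsqrt_trmxC -gram_mx_normalized !mulmxA. Qed.

Lemma Theta_downE A : Theta_down I A = congmx V A.
Proof. by rewrite /congmx trmxC_mul gram_invsqrt_trmxC !mulmxA. Qed.

Lemma Theta_upE B : Theta_up I B = congmx (V ^t*) B.
Proof. by rewrite /congmx trmxCK trmxC_mul gram_invsqrt_trmxC !mulmxA. Qed.

(** [W] and [V] differ by an invertible factor on the right, which can be
    absorbed in the middle matrix: [W M W^*] is [V (D^{1/2} M D^{1/2}) V^*]. *)
Lemma blockconstmx_rangeP (A : 'M[C]_N) :
  reflect (exists B, A = congmx (V ^t*) B) (A \in blockconstmx I).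
Proof.
apply: (iffP (blockconstmxP A)) => [[M ->] | [B ->]].
  have Du : Dinvsqrt \in unitmx by have /mulmx1_unit[] := gram_mx_normalized.
  exists (congmx ((invmx Dinvsqrt) ^t*) M).
  rewrite -[in LHS](mulmxK Du W) /congmx !trmxCK !trmxC_mul.
  by rewrite !mulmxA.
exists (congmx (Dinvsqrt ^t*) B).
by rewrite /congmx !trmxCK trmxC_mul !mulmxA.
Qed.

End Blocks.

Theorem theorem5p2 (R : realType) (N m : nat) (I : 'I_m -> {set 'I_N})
    (N_gt0 : (1 <= N)%N) (I_part : partition_family I) :
  (exists e : 'M[R[i]]_N,
     inverse_star_isos (blockconstmx I) e predT 1%:M
       (Theta_down I) (Theta_up I)) /\
  (forall A : 'M[R[i]]_N, A \in blockconstmx I ->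
     \rank (Theta_down I A) = \rank A) /\
  (forall B : 'M[R[i]]_m, \rank (Theta_up I B) = \rank B) /\
  (forall A : 'M[R[i]]_N, A \in blockconstmx I ->
     (psdmx A <-> psdmx (Theta_down I A))).
Proof.
have V_iso := normalized_incidence_isometry R[i] I_part.
have S_range := @blockconstmx_rangeP R[i] N m I I_part.
split; [|split; [|split]].
- (* The unit is the image V V^* of the identity. *)
  exists (congmx ((incidence_mx R[i] I *m gram_invsqrt R[i] I) ^t*) 1%:M).
  apply: isometry_inverse_star_isos => // [A | B].
    exact: Theta_downE.
  exact: Theta_upE.
- move=> A AS; rewrite Theta_downE //.
  exact: (mxrank_congmx_isometry_in V_iso S_range).
- by move=> B; rewrite Theta_upE // mxrank_congmx_isometry.
- move=> A AS; rewrite Theta_downE //.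
  exact: (psdmx_congmx_isometry_in V_iso S_range).
Qed.
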